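(* Consider the two-task Jacobi problem described in the context, with the relaxed iteration count $\mathcal{L}_\epsilon$. For $\epsilon>0$ let $\omega_\epsilon$ be a minimizer over $\omega\in\mathbb{R}$ of $\mathbb{E}_{\tau\sim P}[\mathcal{L}_\epsilon(\tau;\omega)]$, and let $\omega_m$ be the minimizer over $\omega\in\mathbb{R}$ of $\mathbb{E}_{\tau\sim P}[\mathcal{L}_m(\tau;\omega)]$. Let $p_0$ and $p_\delta$ be the constants defined in the context. (1) $$\lim_{\epsilon\to0}\omega_\epsilon=\begin{cases}\frac1{\mu_1}&\text{if }p>p_0,\\[2pt] \frac1{\mu_2}&\text{if }p<p_0.\end{cases}$$ (2) If $\frac{c_1c_2(\mu_2-\mu_1)}{2(c_1\mu_1+c_2\mu_2)}>\delta_1>\delta_2$ and $p\notin(p_0,p_{\delta_1})$, then for any $\epsilon\le\delta_2$ (with $\epsilon>0$), $$\mathbb{E}_{\tau\sim P}[\mathcal{L}_\epsilon(\tau;\omega_{\delta_1})]>\mathbb{E}_{\tau\sim P}[\mathcal{L}_\epsilon(\tau;\omega_{\delta_2})].$$ (3) For any $c>0$, $\epsilon>0$ and $\delta\ge\epsilon$, there exists a task space $(\mathcal{T},P)$ (of the form described in the context) such that for any $m\ge0$, $$\mathbb{E}_{\tau\sim P}[\mathcal{L}_\epsilon(\tau;\omega_m)]>c\,\mathbb{E}_{\tau\sim P}[\mathcal{L}_\epsilon(\tau;\omega_\delta)].$$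
   Context: Let $A\in\mathbb{R}^{N\times N}$ be the tridiagonal matrix with $2$ on the diagonal and $-1$ on the sub- and superdiagonals (finite-difference discretization of $-d^2/dx^2$ on $[0,1]$ with zero Dirichlet boundary conditions). Its eigenvalues are $2-2\cos\frac{j\pi}{N+1}$, $j=1,\dots,N$. Let $M_J=I-\frac12 A$ be the Jacobi iteration matrix. Let $\mu_1<\mu_2$ be two eigenvalues of $A$ with unit eigenvectors $v_1,v_2$ ($Av_i=\mu_iv_i$, $\|v_i\|=1$ in the Euclidean norm), and let $\lambda_i=1-\frac12\mu_i$ be the corresponding eigenvalues of $M_J$; it is assumed that $\mu_2<2$, so that $0<\lambda_2<\lambda_1<1$ (in particular $N\ge4$). Task space $(\mathcal{T},P)$: $\mathcal{T}=\{\tau_1,\tau_2\}$, where $\tau_i$ is the task of solving $Au=f_i$ with $f_i=c_i\mu_iv_i$ and constant $c_i>0$. The distribution $P$ gives $\tau_1$ with probability $p\in(0,1)$ and $\tau_2$ with probability $1-p$. Solver and meta-solver: for $\omega\in\mathbb{R}$, the initial guess for task $\tau_i$ is $\hat u_i^{(0)}=\omega f_i$, and the Jacobi method produces $\hat u_i^{(k+1)}=M_J\hat u_i^{(k)}+\frac12 f_i$. Thus $\hat u_i^{(m)}-A^{-1}f_i=M_J^m(\hat u_i^{(0)}-A^{-1}f_i)$ for integers $m\ge0$. Losses: the squared error after $m$ iterations is $\mathcal{L}_m(\tau_i;\omega)=\|\hat u_i^{(m)}-A^{-1}f_i\|^2=\lambda_i^{2m}c_i^2(\omega\mu_i-1)^2$.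 The number of iterations is relaxed from $m\in\mathbb{Z}_{\ge0}$ to $m\in\mathbb{R}_{\ge0}$, the last expression being used as the definition for real $m\ge0$. For $\epsilon>0$, $\mathcal{L}_\epsilon(\tau_i;\omega)=\min\{m\in\mathbb{R}_{\ge0}:\sqrt{\mathcal{L}_m(\tau_i;\omega)}\le\epsilon\}$. Expectations are $\mathbb{E}_{\tau\sim P}[F(\tau)]=pF(\tau_1)+(1-p)F(\tau_2)$. Constants: $p_0=\frac{\log\lambda_1}{\log\lambda_1+\log\lambda_2}$. For $0<\delta<\frac{c_1c_2(\mu_2-\mu_1)}{c_1\mu_1+c_2\mu_2}$, put $\omega_{\delta,1}=\frac1{\mu_1}-\frac{\delta}{c_1\mu_1}$, $\omega_{\delta,2}=\frac1{\mu_2}+\frac{\delta}{c_2\mu_2}$ and $$p_\delta=\frac{\log\lambda_1\,\log\frac{\delta}{c_2(\omega_{\delta,1}\mu_2-1)}}{\log\lambda_1\,\log\frac{\delta}{c_2(\omega_{\delta,1}\mu_2-1)}+\log\lambda_2\,\log\frac{\delta}{c_1(1-\omega_{\delta,2}\mu_1)}};$$ $p_0$ is the limit of $p_\delta$ as $\delta\to0$. *)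

(* Defs.v *)
From HB Require Import structures.
From mathcomp Require Import all_boot all_order all_algebra.
From mathcomp Require Import all_classical all_reals all_analysis.
From mathcomp Require Import ring lra zify.

Set Implicit Arguments.
Unset Strict Implicit.
Unset Printing Implicit Defensive.

Import Order.TTheory GRing.Theory Num.Theory.
Import numFieldNormedType.Exports.

Local Open Scope classical_set_scope.
Local Open Scope ring_scope.

Section Defs.
Variable R : realType.

(* The norm `|v| that the library puts on matrices is the sup norm. *)
Definition enorm n (v : 'cV[R]_n) : R := Num.sqrt (\sum_i v i 0 ^+ 2).

Definition laplacian n : 'M[R]_n :=
  \matrix_(i, j) if i == j then 2
                 else if (i.+1 == j :> nat) || (j.+1 == i :> nat) then -1
                 else 0.

Definition jacobi_mx n : 'M[R]_n := 1%:M - 2^-1 *: laplacian n.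

Record task n := Task {
  eigval : R;
  eigvec : 'cV[R]_n;
  scale : R;
  laplacian_eigvec : laplacian n *m eigvec = eigval *: eigvec;
  enorm_eigvec : enorm eigvec = 1;
  scale_gt0 : 0 < scale }.

Definition rhs n (t : task n) : 'cV[R]_n := (scale t * eigval t) *: eigvec t.

Definition solution n (t : task n) : 'cV[R]_n :=
  invmx (laplacian n) *m rhs t.

Definition jacobi_iterate n (t : task n) (w : R) (m : nat) : 'cV[R]_n :=
  iter m (fun u => jacobi_mx n *m u + 2^-1 *: rhs t) (w *: rhs t).

Definition jacobi_eigval n (t : task n) : R := 1 - 2^-1 * eigval t.

(* For a real number m of iterations.  For a natural number m this is the
   squared Euclidean norm of the error of the m-th Jacobi iterate: see
   [loss_nat] below. *)
Definition loss n (m : R) (t : task n) (w : R) : R :=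
  jacobi_eigval t `^ (2 * m) * scale t ^+ 2 * (w * eigval t - 1) ^+ 2.

(* The infimum is attained when 0 < jacobi_eigval t < 1 and 0 < e: see
   [num_iter_min] below. *)
Definition num_iter n (e : R) (t : task n) (w : R) : R :=
  inf [set m : R | 0 <= m /\ Num.sqrt (loss m t w) <= e].

Record task_space := TaskSpace {
  dim : nat;
  task1 : task dim;
  task2 : task dim;
  prob1 : R;
  eigval_lt : eigval task1 < eigval task2;
  eigval2_lt2 : eigval task2 < 2;
  prob1_in01 : 0 < prob1 < 1 }.

Definition expectation (T : task_space) (F : task (dim T) -> R) : R :=
  prob1 T * F (task1 T) + (1 - prob1 T) * F (task2 T).

Definition expected_loss (T : task_space) (m w : R) : R :=
  expectation (fun t : task (dim T) => loss m t w).

Definition expected_num_iter (T : task_space) (e w : R) : R :=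
  expectation (fun t : task (dim T) => num_iter e t w).

Definition is_minimizer (f : R -> R) (x : R) : Prop := forall y, f x <= f y.

Section Constants.
Variable T : task_space.
Let mu1 := eigval (task1 T).
Let mu2 := eigval (task2 T).
Let c1 := scale (task1 T).
Let c2 := scale (task2 T).
Let l1 := jacobi_eigval (task1 T).
Let l2 := jacobi_eigval (task2 T).

Definition p_zero : R := ln l1 / (ln l1 + ln l2).

Definition delta_bound : R := c1 * c2 * (mu2 - mu1) / (c1 * mu1 + c2 * mu2).

Definition omega_delta1 (d : R) : R := 1 / mu1 - d / (c1 * mu1).

Definition omega_delta2 (d : R) : R := 1 / mu2 + d / (c2 * mu2).

Definition p_delta (d : R) : R :=
  let a := ln l1 * ln (d / (c2 * (omega_delta1 d * mu2 - 1))) in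
  let b := ln l2 * ln (d / (c1 * (1 - omega_delta2 d * mu1))) in
  a / (a + b).

End Constants.

Lemma laplacian_unit n : laplacian n \in unitmx.
Proof.
rewrite -row_free_unit -kermx_eq0; apply/rowV0P => v /sub_kermxP vA0.
pose G (k : nat) : R := \sum_(i < n | i == k :> nat) v 0 i.
have GE (i : 'I_n) : G i = v 0 i.
  by rewrite /G (eq_bigl (pred1 i)) ?big_pred1_eq.
have Gn : G n = 0.
  by rewrite /G big_pred0// => i; apply/negbTE; rewrite neq_ltn ltn_ord.
have rec (j : 'I_n) :
    G j.+1 = 2 * G j - (if (j : nat) is k.+1 then G k else 0).
  have := congr1 (fun u : 'rV_n => u 0 j) vA0; rewrite !mxE.
  under eq_bigr => i _.
    have -> : v 0 i * laplacian n i j = 2 * (if i == j then v 0 i else 0)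
      - (if i.+1 == j :> nat then v 0 i else 0)
      - (if i == j.+1 :> nat then v 0 i else 0).
      rewrite mxE -(inj_eq val_inj) /= (eq_sym j.+1).
      case: (eqVneq (i : nat) j) => [->|ij].
        by rewrite !(gtn_eqF (ltnSn _)) (ltn_eqF (ltnSn _)); ring.
      case: (eqVneq i.+1 (j : nat)) => [<-|ij1] /=.
        by rewrite (ltn_eqF (ltnW (ltnSn _))); ring.
      by case: ifP => _; ring.
    over.
  rewrite !sumrB -mulr_sumr -!big_mkcond /= big_pred1_eq -[v 0 j]GE -/(G j.+1).
  have -> : \sum_(i < n | i.+1 == j) v 0 i =
            if (j : nat) is k.+1 then G k else 0.
    by case: (j : nat) => [|k]; [rewrite big_pred0|].
  by move=> /eqP; rewrite subr_eq0 => /eqP <-.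
have Glin k : (k <= n)%N -> G k = k.+1%:R * G 0%N.
  elim/ltn_ind: k => -[|k] IH kn; first by rewrite mul1r.
  rewrite (rec (Ordinal kn)) /= (IH k)// 1?ltnW//.
  case: k IH kn => [|k] IH kn; first by rewrite subr0 mul1r.
  by rewrite (IH k) ?(ltnW (ltnW kn))// -!natr1; ring.
have G0 : G 0%N = 0.
  have /eqP := Glin n (leqnn n); rewrite Gn eq_sym mulf_eq0 pnatr_eq0 /=.
  by move/eqP.
by apply/rowP => j; rewrite mxE -GE Glin ?G0 ?mulr0// ltnW.
Qed.

Lemma enormZ n a (v : 'cV[R]_n) : enorm (a *: v) = `|a| * enorm v.
Proof.
rewrite /enorm; under eq_bigr do rewrite mxE exprMn.
by rewrite -mulr_sumr sqrtrM ?sqr_ge0// sqrtr_sqr.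
Qed.

Lemma solutionE n (t : task n) : solution t = scale t *: eigvec t.
Proof.
rewrite /solution /rhs -scalerA -laplacian_eigvec scalemxAr mulmxA.
by rewrite mulVmx ?mul1mx// laplacian_unit.
Qed.

Lemma jacobi_eigvec n (t : task n) :
  jacobi_mx n *m eigvec t = jacobi_eigval t *: eigvec t.
Proof.
by rewrite mulmxBl mul1mx -scalemxAl laplacian_eigvec scalerA scalerBl scale1r.
Qed.

Lemma jacobi_error n (t : task n) (w : R) (m : nat) :
  jacobi_iterate t w m - solution t =
  (jacobi_eigval t ^+ m * (scale t * (w * eigval t - 1))) *: eigvec t.
Proof.
rewrite solutionE; elim: m => [|m IH].
  rewrite /jacobi_iterate /= /rhs scalerA -scalerBl; congr (_ *: _); ring.
move/eqP: IH; rewrite subr_eq => /eqP IH.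
rewrite /jacobi_iterate iterS -/(jacobi_iterate t w m) IH -scalerDl.
rewrite -scalemxAr jacobi_eigvec /rhs !scalerA -scalerDl -scalerBl.
congr (_ *: _); rewrite exprS /jacobi_eigval; by field.
Qed.

Lemma loss_nat n (t : task n) (w : R) (m : nat) : 0 <= jacobi_eigval t ->
  loss m%:R t w = enorm (jacobi_iterate t w m - solution t) ^+ 2.
Proof.
move=> l0; rewrite jacobi_error enormZ enorm_eigvec mulr1 real_normK ?num_real//.
rewrite /loss -natrM powR_mulrn// mulnC exprM; ring.
Qed.

Lemma num_iter_min n (e : R) (t : task n) (w : R) :
  0 < jacobi_eigval t < 1 -> 0 < e ->
  let S := [set m : R | 0 <= m /\ Num.sqrt (loss m t w) <= e] in
  S (num_iter e t w) /\ lbound S (num_iter e t w).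
Proof.
move=> /andP[l0 l1] e0 S.
set l := jacobi_eigval t in l0 l1.
have lnl0 : ln l < 0 by rewrite ln_lt0// l0.
set K := `|scale t * (w * eigval t - 1)|.
have SE (m : R) : S m <-> 0 <= m /\ l `^ m * K <= e.
  rewrite /S /loss /= -/l mulrC; suff -> : Num.sqrt
    ((w * eigval t - 1) ^+ 2 * (l `^ (2 * m) * scale t ^+ 2)) = l `^ m * K by [].
  rewrite [2 * m]mulrC powRrM powR_mulrn ?powR_ge0//.
  rewrite (_ : _ * _ = (l `^ m * (scale t * (w * eigval t - 1))) ^+ 2); last ring.
  by rewrite sqrtr_sqr normrM ger0_norm ?powR_ge0.
suff [x [Sx xlb]] : exists x : R, S x /\ lbound S x.
  suff -> : num_iter e t w = x by [].
  apply/eqP; rewrite eq_le; apply/andP; split.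
    by apply: ge_inf => //; exists x.
  by apply: lb_le_inf => //; exists x.
have [Ke|eK] := leP K e.
  exists 0; split; last by move=> y [].
  by apply/SE; rewrite powRr0 mul1r.
have K0 : 0 < K by exact: lt_trans eK.
have mono m : (l `^ m * K <= e) = (ln (e / K) / ln l <= m).
  rewrite -ler_pdivlMr// -(@ler_ln _ (l `^ m)) ?posrE ?powR_gt0 ?divr_gt0// ln_powR.
  by rewrite ler_ndivrMr.
exists (ln (e / K) / ln l); split.
  apply/SE; rewrite mono; split=> //; rewrite ltW// nmulr_rgt0 ?invr_lt0//.
  by rewrite ln_lt0// divr_gt0//= ltr_pdivrMr// mul1r.
by move=> y /SE; rewrite mono => -[].
Qed.

End Defs.

(* Main.v *)
(* The expected number of iterations is a weighted sum of two truncated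
   logarithms [max 0 (ln (residual / e))], with weights [p / - ln l1] and
   [(1 - p) / - ln l2].  Away from the two intervals where one residual is below
   [e] it is monotone, and between them it is strictly concave, so for small [e]
   a minimizer must be one of the two inner endpoints, which tend to [1 / mu1]
   and [1 / mu2]; as [e] tends to 0 the endpoint near the root of larger weight
   wins, and [p_zero] is the value of [p] at which the weights agree.  A
   minimizer for [d1], or for [d2 < d1], has both residuals at least [d2], so the
   difference of their costs is the same for every [e <= d2], and at [e = d2] its
   sign is given by minimality.  For the last part both tasks get the same large
   scale, and the first one a small probability. *)

Require Import Defs.
From mathcomp Require Import all_boot all_order all_algebra.
From mathcomp Require Import all_classical all_reals all_analysis.
From mathcomp Require Import ring lra.
Import Order.TTheory GRing.Theory Num.Theory.
Import numFieldNormedType.Exports.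
Local Open Scope classical_set_scope.
Local Open Scope ring_scope.

Set Implicit Arguments.
Unset Strict Implicit.
Unset Printing Implicit Defensive.

(** * Logarithmic excess of a residual over the tolerance *)

Section LogExcess.
Variable R : realType.
Implicit Types e k u : R.

Lemma ln_lt_subr1 u : 0 < u -> u != 1 -> ln u < u - 1.
Proof.
move=> u0 u1; have : ln u != 0 by rewrite ln_eq0.
by move/expR_gt1Dx; rewrite lnK ?posrE// ltrBrDl.
Qed.

(** At [k = 0] the default value [ln 0 = 0] gives excess [0], the right count for a residual that
    already vanishes. *)
Definition log_excess e k : R := Num.max 0 (ln (k / e)).

Lemma log_excess_ge0 e k : 0 <= log_excess e k.
Proof. by rewrite le_max lexx. Qed.

Lemma log_excess_eq0 e k : 0 < e -> k <= e -> log_excess e k = 0.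
Proof.
by move=> e0 ke; apply/max_idPl/ln_le0; rewrite ler_pdivrMr// mul1r.
Qed.

Lemma log_excessE e k : 0 < e -> e <= k -> log_excess e k = ln k - ln e.
Proof.
move=> e0 ek; have k0 := lt_le_trans e0 ek.
rewrite /log_excess ln_div ?posrE//; apply/max_idPr.
by rewrite subr_ge0 ler_ln ?posrE.
Qed.

Lemma log_excess_lt e k k' :
  0 < e -> e <= k -> k < k' -> log_excess e k < log_excess e k'.
Proof.
move=> e0 ek kk'; have k0 := lt_le_trans e0 ek.
rewrite !log_excessE// ?(le_trans ek)// ?ltW// ltrD2r ltr_ln ?posrE//.
exact: lt_trans kk'.
Qed.

Lemma log_excess_ge_ln e k : 0 < e -> 0 < k -> ln k - ln e <= log_excess e k.
Proof. by move=> e0 k0; rewrite -ln_div ?posrE// le_max lexx orbT. Qed.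

(** As a function of [- ln e] the excess has slope 0 or 1. *)
Lemma log_excess_shift e d k : 0 < e -> e <= d ->
  log_excess e k <= log_excess d k + (ln d - ln e).
Proof.
move=> e0 ed; have d0 := lt_le_trans e0 ed.
have lnde : ln e <= ln d by rewrite ler_ln ?posrE.
have [ke|ek] := leP k e.
  by rewrite log_excess_eq0// addr_ge0 ?log_excess_ge0// subr_ge0.
rewrite log_excessE ?(ltW ek)//.
have := @log_excess_ge_ln d k d0 (lt_trans e0 ek). lra.
Qed.

End LogExcess.

(** * Minimizers of a weighted sum of two logarithmic excesses *)

Section Cost.
Variable R : realType.

(** The residual [c_i * |w * mu_i - 1|] is split into a slope [x] or [y], standing for [c_i * mu_i],
    and the distance from [w] to the root [r_i = 1 / mu_i]. *)
Definition cost (P Q r1 x r2 y e w : R) : R :=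
  P * log_excess e (x * `|w - r1|) + Q * log_excess e (y * `|w - r2|).

(** Swapping the tasks and reversing the line preserves the order [r2 < r1], so each one-sided
    argument is needed only once. *)
Lemma cost_reflect (P Q r1 x r2 y e w : R) :
  cost P Q r1 x r2 y e w = cost Q P (- r2) y (- r1) x e (- w).
Proof. by rewrite /cost addrC -!opprD !normrN. Qed.

Lemma minimizer_reflect (P Q r1 x r2 y e w : R) :
  is_minimizer (cost P Q r1 x r2 y e) w ->
  is_minimizer (cost Q P (- r2) y (- r1) x e) (- w).
Proof.
by move=> wmin z; rewrite -cost_reflect (le_trans (wmin (- z)))// cost_reflect opprK.
Qed.

Lemma cost_shift (P Q r1 x r2 y e d w : R) :
  0 < e -> e <= d -> d <= x * `|w - r1| -> d <= y * `|w - r2| ->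
  cost P Q r1 x r2 y e w =
  cost P Q r1 x r2 y d w + (P + Q) * (ln d - ln e).
Proof.
move=> e0 ed dx dy; have d0 := lt_le_trans e0 ed.
rewrite /cost !log_excessE// ?(le_trans ed)//; ring.
Qed.

Lemma dist_kink1 (r1 x e : R) : 0 < x -> 0 <= e -> x * `|r1 - e / x - r1| = e.
Proof.
move=> x0 e0; rewrite addrAC subrr add0r normrN ger0_norm ?divr_ge0// ?ltW//.
by rewrite mulrC divfK ?gt_eqF.
Qed.

Lemma dist_kink2 (r2 y e : R) : 0 < y -> 0 <= e -> y * `|r2 + e / y - r2| = e.
Proof.
move=> y0 e0; rewrite addrAC subrr add0r ger0_norm ?divr_ge0// ?ltW//.
by rewrite mulrC divfK ?gt_eqF.
Qed.

Section Fixed.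
Variables P Q r1 x r2 y e : R.
Hypotheses (P0 : 0 < P) (Q0 : 0 < Q) (x0 : 0 < x) (y0 : 0 < y) (e0 : 0 < e).
Hypothesis gap : e / x + e / y < r1 - r2.

Let f := cost P Q r1 x r2 y e.
Let kinks : [/\ 0 < e / x, 0 < e / y & e / x + e / y < r1 - r2].
Proof. by rewrite !divr_gt0. Qed.

(** [gap] makes the two intervals with a residual below [e] disjoint, so each kink lies strictly
    between the roots and the sign inside the norm is known. *)
Lemma dist_kink1_far : y * `|r1 - e / x - r2| = y * (r1 - r2 - e / x).
Proof.
have [ex0 ey0 gap'] := kinks.
have h : 0 <= r1 - e / x - r2 by lra.
by rewrite ger0_norm//; congr (_ * _); ring.
Qed.

Lemma dist_kink2_far : x * `|r2 + e / y - r1| = x * (r1 - r2 - e / y).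
Proof.
have [ex0 ey0 gap'] := kinks.
have h : r2 + e / y - r1 <= 0 by lra.
by rewrite ler0_norm//; congr (_ * _); ring.
Qed.

Lemma lt_dist_kink1_far : e < y * `|r1 - e / x - r2|.
Proof.
have [ex0 ey0 gap'] := kinks.
rewrite dist_kink1_far -ltr_pdivrMl// mulrC; lra.
Qed.

Lemma lt_dist_kink2_far : e < x * `|r2 + e / y - r1|.
Proof.
have [ex0 ey0 gap'] := kinks.
rewrite dist_kink2_far -ltr_pdivrMl// mulrC; lra.
Qed.

Lemma cost_kink1 :
  f (r1 - e / x) = Q * (ln (y * (r1 - r2 - e / x)) - ln e).
Proof.
rewrite /f /cost dist_kink1 ?ltW// (log_excess_eq0 e0 (lexx _)) mulr0 add0r.
by rewrite log_excessE ?(ltW lt_dist_kink1_far)// dist_kink1_far.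
Qed.

Lemma cost_kink2 :
  f (r2 + e / y) = P * (ln (x * (r1 - r2 - e / y)) - ln e).
Proof.
rewrite /f /cost dist_kink2 ?ltW// (log_excess_eq0 e0 (lexx _)) mulr0 addr0.
by rewrite log_excessE ?(ltW lt_dist_kink2_far)// dist_kink2_far.
Qed.

(** The first term vanishes at the kink, and to its right the second residual strictly grows. *)
Lemma cost_right (w : R) : r1 - e / x < w -> f (r1 - e / x) < f w.
Proof.
have [ex0 ey0 gap'] := kinks.
move=> w1; rewrite /f /cost dist_kink1 ?ltW// (log_excess_eq0 e0 (lexx _)).
rewrite mulr0 add0r -[ltLHS]add0r ler_ltD ?mulr_ge0 ?log_excess_ge0 1?ltW//.
rewrite ltr_pM2l// log_excess_lt//.
  exact: ltW lt_dist_kink1_far.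
have h : 0 <= r1 - e / x - r2 by lra.
have h' : 0 <= w - r2 by lra.
by rewrite ltr_pM2l// !ger0_norm//; lra.
Qed.

(* Strict concavity of the logarithm, in the form of its tangent at [w]: going
   from [w] to one of the two kinks, the tangent of the cost does not go up. *)
Lemma cost_between (w : R) : r2 + e / y < w < r1 - e / x ->
  f (r1 - e / x) < f w \/ f (r2 + e / y) < f w.
Proof.
have [ex0 ey0 gap'] := kinks.
move=> /andP[w2 w1].
have fE (z : R) : r2 + e / y <= z <= r1 - e / x ->
    f z = P * (ln x + ln (r1 - z) - ln e) + Q * (ln y + ln (z - r2) - ln e).
  move=> /andP[z2 z1]; rewrite /f /cost.
  rewrite (ler0_norm (_ : z - r1 <= 0)); last lra.
  rewrite (ger0_norm (_ : 0 <= z - r2)); last lra.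
  rewrite opprB !log_excessE//.
    rewrite !lnM ?posrE//; lra.
  by rewrite -ler_pdivrMl// mulrC; lra.
  by rewrite -ler_pdivrMl// mulrC; lra.
have tangent (z : R) : r2 + e / y <= z <= r1 - e / x -> z != w ->
    f z - f w < (z - w) * (Q / (w - r2) - P / (r1 - w)).
  move=> zI zw; have /andP[z2 z1] := zI.
  have wI : r2 + e / y <= w <= r1 - e / x by rewrite !ltW.
  rewrite !fE//.
  have lnB (a b : R) : 0 < a -> 0 < b -> a != b -> ln a - ln b < (a - b) / b.
    move=> a0 b0 ab; rewrite -ln_div ?posrE// mulrBl divff ?gt_eqF//.
    apply: ln_lt_subr1; first exact: divr_gt0.
    by apply: contra_neq ab => ab1; rewrite -[a](@divfK _ b) ?gt_eqF// ab1 mul1r.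
  have h1 : ln (r1 - z) - ln (r1 - w) < (r1 - z - (r1 - w)) / (r1 - w).
    apply: lnB; [lra|lra|].
    by apply: contra_neq zw => h; lra.
  have h2 : ln (z - r2) - ln (w - r2) < (z - r2 - (w - r2)) / (w - r2).
    apply: lnB; [lra|lra|].
    by apply: contra_neq zw => h; lra.
  rewrite -(ltr_pM2l P0) in h1; rewrite -(ltr_pM2l Q0) in h2.
  have -> : (z - w) * (Q / (w - r2) - P / (r1 - w)) =
    P * ((r1 - z - (r1 - w)) / (r1 - w)) + Q * ((z - r2 - (w - r2)) / (w - r2)).
    ring.
  lra.
(* A nonnegative tangent slope sends [w] left to the kink near [r2], a negative one right to the
   kink near [r1]. *)
have [slope|slope] := leP 0 (Q / (w - r2) - P / (r1 - w)).
  right; rewrite -subr_lt0; have zI : r2 + e / y <= r2 + e / y <= r1 - e / x.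
    by rewrite lexx; lra.
  apply: lt_le_trans (tangent _ zI _) _; first by rewrite lt_eqF.
  by apply: mulr_le0_ge0 => //; lra.
left; rewrite -subr_lt0; have zI : r2 + e / y <= r1 - e / x <= r1 - e / x.
  by rewrite lexx andbT; lra.
apply: lt_le_trans (tangent _ zI _) _; first by rewrite gt_eqF.
by apply: mulr_ge0_le0; [lra|exact: ltW].
Qed.

End Fixed.

Lemma cost_left (P Q r1 x r2 y e w : R) :
  0 < P -> 0 < Q -> 0 < x -> 0 < y -> 0 < e ->
  e / x + e / y < r1 - r2 -> w < r2 + e / y ->
  cost P Q r1 x r2 y e (r2 + e / y) < cost P Q r1 x r2 y e w.
Proof.
move=> P0 Q0 x0 y0 e0 gap w2; rewrite 2!(cost_reflect P) opprD.
by apply: cost_right => //; lra.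
Qed.

Lemma minimizer_kink (P Q r1 x r2 y e w : R) :
  0 < P -> 0 < Q -> 0 < x -> 0 < y -> 0 < e ->
  e / x + e / y < r1 - r2 -> is_minimizer (cost P Q r1 x r2 y e) w ->
  w = r1 - e / x \/ w = r2 + e / y.
Proof.
move=> P0 Q0 x0 y0 e0 gap wmin.
have [w1|w1|->] := ltgtP w (r1 - e / x); last by left.
  have [w2|w2|->] := ltgtP w (r2 + e / y); last by right.
    have := cost_left P0 Q0 x0 y0 e0 gap w2.
    by rewrite ltNge wmin.
  have := cost_between P0 Q0 x0 y0 e0 gap.
  move=> /(_ w); rewrite w1 w2 => /(_ isT) [];
    by rewrite ltNge wmin.
have := cost_right P0 Q0 x0 y0 e0 gap w1.
by rewrite ltNge wmin.
Qed.

(** At a kink one residual equals [e] and the other exceeds it. *)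
Lemma minimizer_dist_ge (P Q r1 x r2 y e w : R) :
  0 < P -> 0 < Q -> 0 < x -> 0 < y -> 0 < e ->
  e / x + e / y < r1 - r2 -> is_minimizer (cost P Q r1 x r2 y e) w ->
  e <= x * `|w - r1| /\ e <= y * `|w - r2|.
Proof.
move=> P0 Q0 x0 y0 e0 gap /minimizer_kink[]// ->.
  rewrite dist_kink1// ?(ltW e0)// lexx; split => //.
  by apply: ltW; apply: lt_dist_kink1_far.
rewrite dist_kink2// ?(ltW e0)// lexx; split => //.
by apply: ltW; apply: lt_dist_kink2_far.
Qed.

(* Once both residuals are at least [d2 >= e], lowering the tolerance from [d2]
   to [e] adds the same amount to both costs. *)
Lemma minimizer_cost_lt (P Q r1 x r2 y e d1 d2 w1 w2 : R) :
  0 < P -> 0 < Q -> 0 < x -> 0 < y -> 0 < e -> e <= d2 -> d2 < d1 ->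
  d1 / x + d1 / y < r1 - r2 ->
  is_minimizer (cost P Q r1 x r2 y d1) w1 ->
  is_minimizer (cost P Q r1 x r2 y d2) w2 ->
  cost P Q r1 x r2 y e w2 < cost P Q r1 x r2 y e w1.
Proof.
move=> P0 Q0 x0 y0 e0 ed2 d21 gap1 min1 min2.
have d20 := lt_le_trans e0 ed2; have d10 := lt_trans d20 d21.
have gap2 : d2 / x + d2 / y < r1 - r2.
  by apply: lt_trans gap1; rewrite ltrD// ltr_pM2r ?invr_gt0.
have [x1 y1] := minimizer_dist_ge P0 Q0 x0 y0 d10 gap1 min1.
have [x2 y2] := minimizer_dist_ge P0 Q0 x0 y0 d20 gap2 min2.
rewrite !(@cost_shift P Q r1 x r2 y e d2)//; [|lra|lra].
(* Strictness: if the costs agreed, [w1] would also be a kink for [d2], with a residual equal to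
   [d2], yet both its residuals are at least [d1]. *)
rewrite ltrD2r lt_neqAle min2 andbT; apply/negP => /eqP cost_eq.
have min1' : is_minimizer (cost P Q r1 x r2 y d2) w1.
  by move=> z; rewrite -cost_eq.
have [w1E|w1E] := minimizer_kink P0 Q0 x0 y0 d20 gap2 min1'.
  by move: x1; rewrite w1E dist_kink1// ?(ltW d20)// leNgt d21.
by move: y1; rewrite w1E dist_kink2// ?(ltW d20)// leNgt d21.
Qed.

Lemma minimizer_cvg (P Q r1 x r2 y : R) (om : R -> R) :
  0 < Q -> Q < P -> 0 < x -> 0 < y -> r2 < r1 ->
  (forall e, 0 < e -> is_minimizer (cost P Q r1 x r2 y e) (om e)) ->
  om e @[e --> 0^'+] --> r1.
Proof.
move=> Q0 QP x0 y0 r21 ommin; have P0 := lt_trans Q0 QP.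
have g0 : 0 < r1 - r2 by rewrite subr_gt0.
(* Below [M], [ln e] makes the kink near [r1] cheaper: its cost is at most
   [Q * (ln (y * (r1 - r2)) - ln e)], and once [e / y] is under half the gap the other cost is at
   least [P * (ln (x * ((r1 - r2) / 2)) - ln e)]. *)
pose M := (P * ln (x * ((r1 - r2) / 2)) - Q * ln (y * (r1 - r2))) / (P - Q).
have omE : {near 0^'+, (fun e => r1 - e / x) =1 om}.
  near=> e.
  have e0 : 0 < e by near: e; exact: nbhs_right_gt.
  have ex : e / x < (r1 - r2) / 2.
    rewrite ltr_pdivrMr//; near: e; apply: nbhs_right_lt.
    by rewrite mulr_gt0// divr_gt0.
  have ey : e / y < (r1 - r2) / 2.
    rewrite ltr_pdivrMr//; near: e; apply: nbhs_right_lt.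
    by rewrite mulr_gt0// divr_gt0.
  have eM : ln e < M.
    rewrite -ltr_expR lnK ?posrE//; near: e; apply: nbhs_right_lt.
    exact: expR_gt0.
  have ex0 : 0 < e / x by exact: divr_gt0.
  have ey0 : 0 < e / y by exact: divr_gt0.
  have gap : e / x + e / y < r1 - r2 by lra.
  have [->//|omE] := minimizer_kink P0 Q0 x0 y0 e0 gap (ommin e e0).
  have := ommin e e0 (r1 - e / x).
  rewrite omE cost_kink1// cost_kink2//.
  have h1 : ln (y * (r1 - r2 - e / x)) <= ln (y * (r1 - r2)).
    by rewrite ler_ln ?posrE ?mulr_gt0 ?ler_pM2l//; lra.
  have h2 : ln (x * ((r1 - r2) / 2)) <= ln (x * (r1 - r2 - e / y)).
    by rewrite ler_ln ?posrE ?mulr_gt0 ?ler_pM2l ?divr_gt0//; lra.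
  move: eM; rewrite ltr_pdivlMr ?subr_gt0//.
  rewrite -(ler_pM2l Q0) in h1; rewrite -(ler_pM2l P0) in h2.
  by lra.
apply: cvg_trans (near_eq_cvg omE) _.
apply: cvg_at_right_filter.
(* The limit must appear as the value at [0] of [fun e => r1 - e / x]. *)
have -> : nbhs r1 = nbhs (r1 - 0 / x) by rewrite mul0r subr0.
apply: cvgB; first exact: cvg_cst.
by apply: cvgMl; exact: cvg_id.
Unshelve. all: by end_near. Qed.

End Cost.

(** * From tasks to costs: positive eigenvalues and closed-form iteration counts *)

Section Tasks.
Variable R : realType.

Lemma eigvec_neq0 n (t : task R n) : eigvec t != 0.
Proof.
apply: contra_eq_neq (enorm_eigvec t) => ->.
rewrite /enorm big1 ?sqrtr0 ?(eq_sym 0) ?oner_eq0// => i _.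
by rewrite mxE expr0n.
Qed.

Lemma eigval_neq0 n (t : task R n) : eigval t != 0.
Proof.
apply: contraNneq (eigvec_neq0 t) => mu0.
rewrite -[eigvec t](mulKmx (laplacian_unit R n)) laplacian_eigvec mu0.
by rewrite scale0r mulmx0.
Qed.

(* Gershgorin's argument at an entry of largest absolute value. *)
Lemma eigval_ge0 n (t : task R n) : 0 <= eigval t.
Proof.
set v := eigvec t; set mu := eigval t.
have /cV0Pn[i0 vi0] := eigvec_neq0 t.
case: (arg_maxP (fun i => `|v i 0|) (isT : xpredT i0)) => i _ imaxT.
have imax j : `|v j 0| <= `|v i 0| := imaxT j isT.
have vi : 0 < `|v i 0|.
  by apply: lt_le_trans (imax i0); rewrite normr_gt0.
have := congr1 (fun u : 'cV_n => u i 0) (laplacian_eigvec t).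
rewrite !mxE -/v -/mu (bigD1 i)//= mxE eqxx => eqi.
(* Row [i] has at most one entry on each side of the diagonal, so each side contributes at most
   [|v i 0|]. *)
have row_le1 (P : pred 'I_n) : {in P &, forall j k, j = k} ->
    \sum_(j | P j) `|v j 0| <= `|v i 0|.
  move=> Punique; have [j Pj|P0] := pickP P; last by rewrite big_pred0.
  rewrite (big_pred1 j) => [|k]; first exact: imax.
  apply/idP/eqP => [Pk|->//].
  exact: Punique.
have offdiag : `|\sum_(j < n | j != i) laplacian R n i j * v j 0| <= 2 * `|v i 0|.
  apply: le_trans (ler_norm_sum _ _ _) _.
  have -> : 2 * `|v i 0| = `|v i 0| + `|v i 0| by ring.
  apply: (@le_trans _ _ (\sum_(j < n | i.+1 == j :> nat) `|v j 0| +
                         \sum_(j < n | j.+1 == i :> nat) `|v j 0|)).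
    rewrite !(big_mkcond (fun j : 'I_n => _ == _ :> nat)) (big_mkcond (fun j => j != i)).
    rewrite -big_split/=; apply: ler_sum => j _; rewrite eq_sym.
    case: ifPn => [ij|_]; last by do 2 case: ifP => _; rewrite ?addr_ge0.
    rewrite normrM mxE (negbTE ij).
    case: (i.+1 == j :> nat) => /=; last case: (j.+1 == i :> nat) => /=.
      by rewrite normrN1 mul1r lerDl; case: ifP.
      by rewrite normrN1 mul1r add0r.
      by rewrite normr0 mul0r addr0.
  apply: lerD; apply: row_le1 => j k; rewrite -!topredE => /eqP ji /eqP ki.
    by apply/val_inj; rewrite /= -ji -ki.
  by apply/val_inj/succn_inj; rewrite ji ki.
have : `|2 - mu| * `|v i 0| <= 2 * `|v i 0|.
  rewrite -normrM (_ : (2 - mu) * v i 0 =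
    - \sum_(j < n | j != i) laplacian R n i j * v j 0) ?normrN//.
  by rewrite mulrBl -eqi; ring.
rewrite ler_pM2r// ler_norml; lra.
Qed.

(** Gershgorin's bound gives only nonnegativity; invertibility of the matrix excludes zero. *)
Lemma eigval_gt0 n (t : task R n) : 0 < eigval t.
Proof. by rewrite lt_neqAle eq_sym eigval_neq0 eigval_ge0. Qed.

Lemma jacobi_eigval_in01 n (t : task R n) : eigval t < 2 -> 0 < jacobi_eigval t < 1.
Proof. by have := eigval_gt0 t; rewrite /jacobi_eigval; lra. Qed.

Lemma ln_jacobi_eigval n (t : task R n) : eigval t < 2 -> 0 < - ln (jacobi_eigval t).
Proof. by move=> t2; rewrite oppr_gt0 ln_lt0// jacobi_eigval_in01. Qed.

(** Taking logarithms in [l ^ m * K <= e] bounds [m] below by [ln (K / e) / - ln l]; the constraint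
    [0 <= m] supplies the truncation. *)
Lemma num_iterE n (e : R) (t : task R n) (w : R) : eigval t < 2 -> 0 < e ->
  num_iter e t w =
  log_excess e (scale t * eigval t * `|w - 1 / eigval t|) / - ln (jacobi_eigval t).
Proof.
move=> t2 e0; have l01 := jacobi_eigval_in01 t2.
have a0 := ln_jacobi_eigval t2; have c0 := scale_gt0 t; have mu0 := eigval_gt0 t.
set K := _ * `|_|; set l := jacobi_eigval t in a0 *.
have l0 : 0 < l by case/andP: l01.
have lossE m : Num.sqrt (loss m t w) = l `^ m * K.
  rewrite /loss -/l [2 * m]mulrC powRrM powR_mulrn ?powR_ge0//.
  rewrite -!exprMn sqrtr_sqr -mulrA normrM ger0_norm ?powR_ge0//; congr (_ * _).
  rewrite /K -[X in _ = X * _]gtr0_norm ?mulr_gt0// -normrM; congr `|_|.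
  by field; rewrite gt_eqF.
have [[m0 mK] mlb] := num_iter_min w l01 e0; rewrite lossE in mK.
set m := num_iter e t w in m0 mK mlb *.
have K0 : 0 <= K by rewrite mulr_ge0// ltW ?mulr_gt0.
have lnl m' k : 0 < k -> (l `^ m' * k <= e) = (ln (k / e) / - ln l <= m').
  move=> k0; rewrite -ler_pdivlMr// -(@ler_ln _ (l `^ m')) ?posrE ?powR_gt0 ?divr_gt0//.
  rewrite ln_powR !ln_div ?posrE// ler_pdivrMr//; apply/idP/idP; lra.
apply/eqP; rewrite eq_le; apply/andP; split.
  apply: mlb; split; first by rewrite divr_ge0 ?log_excess_ge0// ltW.
  (* [K = 0] occurs at the root [w = 1 / mu], where [lnl] does not apply. *)
  rewrite lossE; have [->|Kn0] := eqVneq K 0; first by rewrite mulr0 ltW.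
  rewrite lnl ?lt_neqAle 1?eq_sym ?Kn0//.
  by rewrite ler_pM2r ?invr_gt0// le_max lexx orbT.
have [Ke|eK] := leP K e; first by rewrite log_excess_eq0// mul0r.
have Kp := lt_trans e0 eK.
by rewrite log_excessE ?(ltW eK)// -ln_div ?posrE// -lnl.
Qed.

Section Space.
Variable T : task_space R.

Lemma eigval1_lt2 : eigval (task1 T) < 2.
Proof. exact: lt_trans (eigval_lt T) (eigval2_lt2 T). Qed.

Definition weight1 : R := prob1 T / - ln (jacobi_eigval (task1 T)).
Definition weight2 : R := (1 - prob1 T) / - ln (jacobi_eigval (task2 T)).

Lemma weight1_gt0 : 0 < weight1.
Proof.
have /andP[p0 p1] := prob1_in01 T.
by rewrite divr_gt0 ?ln_jacobi_eigval ?eigval1_lt2.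
Qed.

Lemma weight2_gt0 : 0 < weight2.
Proof.
have /andP[p0 p1] := prob1_in01 T.
by rewrite divr_gt0 ?subr_gt0 ?ln_jacobi_eigval ?eigval2_lt2.
Qed.

Lemma expected_num_iterE (e w : R) : 0 < e ->
  expected_num_iter T e w =
  cost weight1 weight2 (1 / eigval (task1 T)) (scale (task1 T) * eigval (task1 T))
    (1 / eigval (task2 T)) (scale (task2 T) * eigval (task2 T)) e w.
Proof.
move=> e0; rewrite /expected_num_iter /Defs.expectation /cost.
rewrite !num_iterE ?eigval1_lt2 ?eigval2_lt2// /weight1 /weight2; ring.
Qed.

Lemma lt_p_zero : (p_zero T < prob1 T) = (weight2 < weight1).
Proof.
have a1 := ln_jacobi_eigval eigval1_lt2; have a2 := ln_jacobi_eigval (eigval2_lt2 T).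
rewrite /p_zero /weight1 /weight2.
set l1 := ln _ in a1 *; set l2 := ln _ in a2 *.
rewrite ltr_ndivrMr; last lra.
by rewrite ltr_pdivrMr// mulrAC ltr_pdivlMr//; apply/idP/idP; lra.
Qed.

Lemma gt_p_zero : (prob1 T < p_zero T) = (weight1 < weight2).
Proof.
have a1 := ln_jacobi_eigval eigval1_lt2; have a2 := ln_jacobi_eigval (eigval2_lt2 T).
rewrite /p_zero /weight1 /weight2.
set l1 := ln _ in a1 *; set l2 := ln _ in a2 *.
rewrite ltr_ndivlMr; last lra.
by rewrite ltr_pdivrMr// mulrAC ltr_pdivlMr//; apply/idP/idP; lra.
Qed.

(** [delta_bound] is the tolerance at which the two intervals around the roots touch. *)
Lemma delta_bound_gap (d : R) : d < delta_bound T ->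
  d / (scale (task1 T) * eigval (task1 T)) + d / (scale (task2 T) * eigval (task2 T)) <
  1 / eigval (task1 T) - 1 / eigval (task2 T).
Proof.
have c1 := scale_gt0 (task1 T); have c2 := scale_gt0 (task2 T).
have m1 := eigval_gt0 (task1 T); have m2 := eigval_gt0 (task2 T).
rewrite /delta_bound.
move: (scale (task1 T)) (scale (task2 T)) c1 c2 => a b a0 b0.
move: (eigval (task1 T)) (eigval (task2 T)) m1 m2 => x y x0 y0.
have s0 : 0 < a * x + b * y by rewrite addr_gt0 ?mulr_gt0.
rewrite ltr_pdivlMr// => H; rewrite -subr_gt0.
have -> : 1 / x - 1 / y - (d / (a * x) + d / (b * y)) =
   (a * b * (y - x) - d * (a * x + b * y)) / (a * b * x * y).
  by field; rewrite !gt_eqF//; lra.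
by rewrite divr_gt0 ?mulr_gt0// subr_gt0.
Qed.

End Space.
End Tasks.

(** * Making the ratio of expected iteration counts arbitrarily large *)

Section LargeRatio.
Variable R : realType.

(** Compare with [r2], where the second term vanishes, then pay for lowering the tolerance from [d]
    to [e]. *)
Lemma minimizer_cost_le (P Q r1 x r2 y e d w : R) :
  0 <= P -> 0 <= Q -> 0 < e -> e <= d ->
  is_minimizer (cost P Q r1 x r2 y d) w ->
  cost P Q r1 x r2 y e w <=
  P * log_excess d (x * `|r2 - r1|) + (P + Q) * (ln d - ln e).
Proof.
move=> P0 Q0 e0 ed /(_ r2); have d0 := lt_le_trans e0 ed.
rewrite /cost subrr normr0 mulr0 [log_excess d 0]log_excess_eq0 ?(ltW d0)// mulr0 addr0.
have := ler_wpM2l P0 (log_excess_shift (x * `|w - r1|) e0 ed).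
have := ler_wpM2l Q0 (log_excess_shift (y * `|w - r2|) e0 ed).
lra.
Qed.

(** Completing the square: the objective at [w] exceeds its value at the quotient [z] by
    [S * (w - z) ^+ 2]. *)
Lemma least_squares_minimizer (a b x y w : R) : 0 < a * x ^+ 2 + b * y ^+ 2 ->
  is_minimizer (fun w => a * (w * x - 1) ^+ 2 + b * (w * y - 1) ^+ 2) w ->
  w = (a * x + b * y) / (a * x ^+ 2 + b * y ^+ 2).
Proof.
set S := a * _ + _; set z := _ / S => S0 /(_ z) wz.
have zS : a * x + b * y = z * S by rewrite divfK ?gt_eqF.
have : S * (w - z) ^+ 2 <= 0.
  have -> : S * (w - z) ^+ 2 = a * (w * x - 1) ^+ 2 + b * (w * y - 1) ^+ 2 -
     (a * (z * x - 1) ^+ 2 + b * (z * y - 1) ^+ 2) +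
     2 * (w - z) * ((a * x + b * y) - z * S) by rewrite /S; ring.
  by rewrite zS subrr mulr0 addr0 subr_le0.
rewrite pmulr_rle0// => wz0; apply/eqP; rewrite -subr_eq0 -sqrf_eq0 eq_le wz0.
exact: sqr_ge0.
Qed.

(* The weight of the first task in the least squares problem only increases
   with [m], since its Jacobi eigenvalue is the larger one. *)
Lemma expected_loss_minimizer_ge (T : task_space R) (m w : R) :
  let mu1 := eigval (task1 T) in let mu2 := eigval (task2 T) in
  let p := prob1 T in
  scale (task1 T) = scale (task2 T) -> 0 <= m ->
  is_minimizer (expected_loss T m) w ->
  p * mu1 * (mu2 - mu1) / (p * mu1 ^+ 2 + (1 - p) * mu2 ^+ 2) <= w * mu2 - 1.
Proof.
move=> mu1 mu2 p s12 m0 wmin.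
have x0 : 0 < mu1 by exact: eigval_gt0.
have y0 : 0 < mu2 by exact: eigval_gt0.
have xy : mu1 < mu2 by exact: eigval_lt.
have /andP[p0 p1] : 0 < p < 1 by exact: prob1_in01.
have /andP[l10 _] := jacobi_eigval_in01 (eigval1_lt2 T).
have /andP[l20 _] := jacobi_eigval_in01 (eigval2_lt2 T).
pose A := jacobi_eigval (task1 T) `^ (2 * m) * scale (task2 T) ^+ 2.
pose B := jacobi_eigval (task2 T) `^ (2 * m) * scale (task2 T) ^+ 2.
have s20 : 0 < scale (task2 T) ^+ 2 by rewrite exprn_gt0 ?scale_gt0.
have A0 : 0 < A by rewrite mulr_gt0 ?powR_gt0.
have B0 : 0 < B by rewrite mulr_gt0 ?powR_gt0.
have BA : B <= A.
  rewrite ler_pM2r//; apply: ge0_ler_powR; rewrite ?nnegrE ?mulr_ge0// ?ltW//.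
  by rewrite /jacobi_eigval -/mu1 -/mu2; lra.
have q0 : 0 < 1 - p by rewrite subr_gt0.
have S0 : 0 < p * A * mu1 ^+ 2 + (1 - p) * B * mu2 ^+ 2.
  by apply: addr_gt0; apply: mulr_gt0; rewrite ?exprn_gt0// mulr_gt0.
have S1 : 0 < p * mu1 ^+ 2 + (1 - p) * mu2 ^+ 2.
  by apply: addr_gt0; apply: mulr_gt0; rewrite ?exprn_gt0.
rewrite (@least_squares_minimizer _ _ _ _ w S0); last first.
  move=> z; move: (wmin z).
  rewrite /expected_loss /Defs.expectation /loss s12 -/A -/B -/mu1 -/mu2 -/p.
  by rewrite !mulrA.
have -> : (p * A * mu1 + (1 - p) * B * mu2) /
    (p * A * mu1 ^+ 2 + (1 - p) * B * mu2 ^+ 2) * mu2 - 1 =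
    p * A * mu1 * (mu2 - mu1) / (p * A * mu1 ^+ 2 + (1 - p) * B * mu2 ^+ 2).
  by field; rewrite gt_eqF.
(* The bound is the value of this quotient at [A = B], hence free of [m] and of the scale;
   cross-multiplied, the difference is a nonnegative multiple of [A - B]. *)
rewrite ler_pdivrMr// [leRHS]mulrAC ler_pdivlMr//.
rewrite -subr_ge0.
have -> : p * A * mu1 * (mu2 - mu1) * (p * mu1 ^+ 2 + (1 - p) * mu2 ^+ 2) -
    p * mu1 * (mu2 - mu1) * (p * A * mu1 ^+ 2 + (1 - p) * B * mu2 ^+ 2) =
    p * mu1 * (mu2 - mu1) * ((1 - p) * mu2 ^+ 2) * (A - B) by ring.
by rewrite !mulr_ge0// ?sqr_ge0 ?subr_ge0// ltW.
Qed.

Definition rescale n (t : task R n) (s : R) (s0 : 0 < s) : task R n :=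
  Task (laplacian_eigvec t) (enorm_eigvec t) s0.

Lemma exists_small_weight (a b c : R) : 0 < a -> 0 < b -> 0 < c ->
  exists2 p, 0 < p < 1 & c * (p / a) < (1 - p) / b.
Proof.
move=> a0 b0 c0; have s0 : 0 < a + (1 + c) * b by rewrite addr_gt0 ?mulr_gt0 ?addr_gt0.
(* This [p] makes the ratio of [(1 - p) / b] to [p / a] equal to [1 + c]. *)
exists (a / (a + (1 + c) * b)).
  by rewrite divr_gt0//= ltr_pdivrMr// mul1r ltrDl mulr_gt0 ?addr_gt0.
have -> : (1 - a / (a + (1 + c) * b)) / b = (1 + c) / (a + (1 + c) * b).
  by field; rewrite !gt_eqF.
have -> : c * (a / (a + (1 + c) * b) / a) = c / (a + (1 + c) * b).
  by field; rewrite !gt_eqF.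
by rewrite ltr_pM2r ?invr_gt0// ltrDr.
Qed.

(* With a common scale [s], both expected numbers of iterations grow like a
   multiple of [ln s]: that of [w_m] like [weight2 T * ln s], and that of [w_d]
   at most like [weight1 T * ln s].  The probability of the first task is small
   enough to make [c * weight1 T < weight2 T]. *)
Lemma large_ratio n (t1 t2 : task R n) (c e d : R) :
  eigval t1 < eigval t2 -> eigval t2 < 2 -> 0 < c -> 0 < e -> e <= d ->
  exists T : task_space R,
    forall w_d : R, is_minimizer (expected_num_iter T d) w_d ->
    forall m w_m : R, 0 <= m -> is_minimizer (expected_loss T m) w_m ->
      c * expected_num_iter T e w_d < expected_num_iter T e w_m.
Proof.
move=> t12 t22 c0 e0 ed; have d0 := lt_le_trans e0 ed.
have x0 := eigval_gt0 t1; have y0 := eigval_gt0 t2.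
set mu1 := eigval t1 in t12 x0; set mu2 := eigval t2 in t12 t22 y0.
have a10 := ln_jacobi_eigval (lt_trans t12 t22); have a20 := ln_jacobi_eigval t22.
set a1 := - ln _ in a10; set a2 := - ln _ in a20.
have [p p01 cPQ] := exists_small_weight a10 a20 c0.
have /andP[p0 p1] := p01; have q0 : 0 < 1 - p by rewrite subr_gt0.
have P0 : 0 < p / a1 by rewrite divr_gt0.
have Q0 : 0 < (1 - p) / a2 by rewrite divr_gt0.
set P := p / a1 in cPQ P0; set Q := (1 - p) / a2 in cPQ Q0.
(* The first task's residual at the root [1 / mu2], for scale 1. *)
pose k := mu1 * `|1 / mu2 - 1 / mu1|.
have k0 : 0 < k.
  rewrite mulr_gt0// normr_gt0 subr_eq0 !div1r (inj_eq invr_inj).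
  by rewrite gt_eqF.
pose kappa := p * mu1 * (mu2 - mu1) / (p * mu1 ^+ 2 + (1 - p) * mu2 ^+ 2).
have kappa0 : 0 < kappa.
  by apply: divr_gt0; rewrite ?addr_gt0 ?mulr_gt0 ?exprn_gt0 ?subr_gt0.
(* [M] collects the terms free of [L] in the final comparison. The first argument of the maximum
   ensures [d <= s * k], the second [M < (Q - c * P) * L]. *)
pose M := c * (P * (ln k - ln d) + (P + Q) * (ln d - ln e)) - Q * (ln kappa - ln e).
pose L := Num.max (ln d - ln k) (M / (Q - c * P) + 1).
have Ld : ln d - ln k <= L by rewrite le_max lexx.
have ML : M < (Q - c * P) * L.
  rewrite mulrC -ltr_pdivrMr ?subr_gt0//.
  by apply: (@lt_le_trans _ _ (M / (Q - c * P) + 1)); rewrite ?ltrDl// le_max lexx orbT.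
pose s := expR L.
have s0 : 0 < s by exact: expR_gt0.
have lns : ln s = L by rewrite expRK.
pose T := @TaskSpace R n (rescale t1 s0) (rescale t2 s0) p t12 t22 p01.
exists T => w_d wd_min m w_m m0 wm_min.
have := @expected_loss_minimizer_ge T m w_m erefl m0 wm_min.
rewrite -/kappa => wm_ge.
pose f := cost P Q (1 / mu1) (s * mu1) (1 / mu2) (s * mu2).
have fE b z : 0 < b -> expected_num_iter T b z = f b z.
  exact: expected_num_iterE.
have wd_min' : is_minimizer (f d) w_d by move=> z; rewrite -!fE.
have := minimizer_cost_le (ltW P0) (ltW Q0) e0 ed wd_min'.
have -> : s * mu1 * `|1 / mu2 - 1 / mu1| = s * k by rewrite mulrA.
have dsk : d <= s * k.
  by rewrite -ler_ln ?posrE ?(mulr_gt0 s0 k0)// lnM ?posrE// lns; lra.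
rewrite -/(f e w_d) -fE// (log_excessE d0 dsk) lnM ?posrE// lns => wd_le.
have wm_far : s * kappa <= s * mu2 * `|w_m - 1 / mu2|.
  rewrite -mulrA ler_pM2l// -[X in X * _](gtr0_norm y0) -normrM.
  apply: le_trans wm_ge (le_trans (ler_norm _) _).
  by rewrite mulrBr mul1r divff ?gt_eqF// mulrC.
have sk0 : 0 < s * kappa := mulr_gt0 s0 kappa0.
have wm_le : Q * (L + ln kappa - ln e) <= expected_num_iter T e w_m.
  rewrite fE// /f /cost -[leLHS]add0r.
  apply: lerD; first by rewrite mulr_ge0 ?log_excess_ge0 ?(ltW P0).
  rewrite ler_pM2l//.
  apply: le_trans (log_excess_ge_ln e0 (lt_le_trans sk0 wm_far)).
  rewrite lerD2r -lns -lnM ?posrE// ler_ln ?posrE//.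
  exact: lt_le_trans wm_far.
apply: lt_le_trans wm_le; apply: (le_lt_trans (ler_wpM2l (ltW c0) wd_le)).
move: ML; rewrite /M; lra.
Qed.

End LargeRatio.

(** * Two explicit eigenvectors with eigenvalues below 2 *)

Section DimensionFive.
Variable R : realType.

Definition col5 (x0 x1 x2 x3 x4 : R) : 'cV[R]_5 :=
  \col_i nth 0 [:: x0; x1; x2; x3; x4] i.

Lemma laplacian_col5 (x0 x1 x2 x3 x4 : R) :
  laplacian R 5 *m col5 x0 x1 x2 x3 x4 =
  col5 (2 * x0 - x1) (2 * x1 - x0 - x2) (2 * x2 - x1 - x3) (2 * x3 - x2 - x4)
       (2 * x4 - x3).
Proof.
apply/colP => i; rewrite !mxE !big_ord_recl big_ord0 !mxE /=.
by case: i => -[|[|[|[|[|//]]]]] ilt /=; ring.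
Qed.

Lemma enorm_col5 (x0 x1 x2 x3 x4 : R) :
  x0 ^+ 2 + x1 ^+ 2 + x2 ^+ 2 + x3 ^+ 2 + x4 ^+ 2 = 1 ->
  enorm (col5 x0 x1 x2 x3 x4) = 1.
Proof.
move=> sum1; rewrite /enorm !big_ord_recl big_ord0 !mxE /= addr0 !addrA sum1.
exact: sqrtr1.
Qed.

(* [sin (k * pi / 6)] for [1 <= k <= 5], normalized *)
Lemma task5_eigval1 : exists t : task R 5, eigval t = 2 - Num.sqrt 3.
Proof.
pose s : R := Num.sqrt 3; have s2 : s ^+ 2 = 3 by rewrite sqr_sqrtr.
pose v := col5 (s / 6) (1 / 2) (s / 3) (1 / 2) (s / 6).
have Av : laplacian R 5 *m v = (2 - s) *: v.
  rewrite laplacian_col5; apply/colP => i; rewrite !mxE.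
  have ss : s * s = 3 by rewrite -expr2.
  by case: i => -[|[|[|[|[|//]]]]] ilt /=; lra.
have v1 : enorm v = 1 by apply: enorm_col5; rewrite !exprMn s2; field.
by exists (Task Av v1 ltr01).
Qed.

(* [sin (k * pi / 3)] for [1 <= k <= 5], normalized *)
Lemma task5_eigval2 : exists t : task R 5, eigval t = 1.
Proof.
pose v : 'cV[R]_5 := col5 (1 / 2) (1 / 2) 0 (- (1 / 2)) (- (1 / 2)).
have Av : laplacian R 5 *m v = 1 *: v.
  rewrite laplacian_col5; apply/colP => i; rewrite !mxE.
  by case: i => -[|[|[|[|[|//]]]]] ilt /=; lra.
have v1 : enorm v = 1 by apply: enorm_col5; field.
by exists (Task Av v1 ltr01).
Qed.

End DimensionFive.

(** * The three claims assembled *)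

Unset Implicit Arguments.

Theorem proposition3p1 (R : realType) :
  (forall (T : task_space R) (omega : R -> R),
    (forall e : R, 0 < e -> is_minimizer (expected_num_iter T e) (omega e)) ->
    ((p_zero T < prob1 T ->
        omega e @[e --> 0^'+] --> 1 / eigval (task1 T)) /\
     (prob1 T < p_zero T ->
        omega e @[e --> 0^'+] --> 1 / eigval (task2 T))) /\
    (forall d1 d2 : R,
       d1 < delta_bound T / 2 -> d2 < d1 ->
       ~ (p_zero T < prob1 T < p_delta T d1) ->
       forall e : R, 0 < e -> e <= d2 ->
         expected_num_iter T e (omega d2) < expected_num_iter T e (omega d1)))
  /\
  (forall c e d : R, 0 < c -> 0 < e -> e <= d ->
     exists T : task_space R,
       forall w_d : R, is_minimizer (expected_num_iter T d) w_d ->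
       forall m w_m : R, 0 <= m -> is_minimizer (expected_loss T m) w_m ->
         c * expected_num_iter T e w_d < expected_num_iter T e w_m).
Proof.
split; last first.
  move=> c e d c0 e0 ed.
  have [t1 mu1] := task5_eigval1 R; have [t2 mu2] := task5_eigval2 R.
  apply: (@large_ratio _ _ t1 t2) => //; rewrite mu2 ?ltr1n// mu1.
  have : (1 : R) < Num.sqrt 3 by rewrite -[ltLHS]sqrtr1 ltr_sqrt ?ltr1n.
  lra.
move=> T omega omega_min.
have mu1 := eigval_gt0 (task1 T); have mu2 := eigval_gt0 (task2 T).
have x0 := mulr_gt0 (scale_gt0 (task1 T)) mu1.
have y0 := mulr_gt0 (scale_gt0 (task2 T)) mu2.
have r21 : 1 / eigval (task2 T) < 1 / eigval (task1 T).
  by rewrite !div1r ltf_pV2 ?posrE// eigval_lt.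
have P0 := weight1_gt0 T; have Q0 := weight2_gt0 T.
pose f := cost (weight1 T) (weight2 T) (1 / eigval (task1 T))
  (scale (task1 T) * eigval (task1 T)) (1 / eigval (task2 T))
  (scale (task2 T) * eigval (task2 T)).
have omega_minf e : 0 < e -> is_minimizer (f e) (omega e).
  by move=> e0 z; rewrite /f -!expected_num_iterE//; apply: omega_min.
split; first split.
- by rewrite lt_p_zero => QP; apply: (minimizer_cvg Q0 QP x0 y0 r21).
(* The reflected problem has its heavier root at [- (1 / mu2)], so the previous case applies to
   [- omega]. *)
- rewrite gt_p_zero => PQ; rewrite -[X in _ --> X]opprK.
  have -> : omega = fun e => - - omega e by apply/funext => e; rewrite opprK.
  apply: cvgN; apply: (minimizer_cvg P0 PQ y0 x0 (_ : - (1 / eigval (task1 T)) < _)).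
    by rewrite ltrN2.
  by move=> e e0; apply: minimizer_reflect; exact: omega_minf.
- move=> d1 d2 d1D d21 _ e e0 ed2; rewrite !expected_num_iterE//.
  have d10 : 0 < d1 by rewrite (lt_trans _ d21)// (lt_le_trans e0).
  apply: (minimizer_cost_lt P0 Q0 x0 y0 e0 ed2 d21).
  + apply: delta_bound_gap; lra.
  + exact: omega_minf.
  + by apply: omega_minf; exact: lt_le_trans ed2.
Qed.
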